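(* Let $k>0$, $\theta>0$, and let $X_1,\dots,X_n$ be i.i.d. Gamma random variables with shape parameter $k$ and scale parameter $\theta$. Let $\widehat{\boldsymbol\theta}=\frac{1}{kn}\sum_{i=1}^nX_i$. Let $\varepsilon>0$ and $0<\delta<1$, and define $$\zeta=2C_{\mathrm{BE}}\Big(3+\frac6k\Big)^{3/4}\sqrt{\frac{k[\varepsilon-\ln(1+\varepsilon)]}{\ln\frac1\delta}}.$$ Then $\Pr\{|\widehat{\boldsymbol\theta}-\theta|<\varepsilon\theta\}>1-\delta$ provided that $$n>\frac{\ln\frac{1+\zeta}{\delta}}{k[\varepsilon-\ln(1+\varepsilon)]}.$$
   Context: $C_{\mathrm{BE}}$ denotes the absolute constant in the Berry–Esseen inequality: for i.i.d. $Y_1,Y_2,\dots$ distributed as $Y$ with $\mathbb{E}[Y]=0$, $\mathbb{E}[Y^2]>0$, $\mathbb{E}[|Y|^3]<\infty$, the cdf $F_n$ of $\sum_{i=1}^nY_i/\sqrt{n\mathbb{E}[Y^2]}$ satisfies $|F_n(y)-\Phi(y)|\le\frac{C_{\mathrm{BE}}}{\sqrt n}\frac{\mathbb{E}[|Y|^3]}{\mathbb{E}^{3/2}[Y^2]}$ for all $y,n$, where $\Phi$ is the standard normal cdf. *)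

(* Defs.v *)
From HB Require Import structures.
From mathcomp Require Import all_boot all_order all_algebra.
From mathcomp Require Import all_classical all_reals all_analysis.
From mathcomp Require Import normal_distribution.
Set Implicit Arguments. Unset Strict Implicit. Unset Printing Implicit Defensive.
Import Order.TTheory GRing.Theory Num.Theory.
Import numFieldNormedType.Exports.
Local Open Scope classical_set_scope.
Local Open Scope ring_scope.

Definition mutually_independent {d} {T : measurableType d} {R : realType}
  (P : probability T R) (I : eqType) (Y : I -> {RV P >-> R}) : Prop :=
  forall (s : seq I) (B : I -> set R), uniq s ->
    (forall i, measurable (B i)) ->
    P (\bigcap_(i in [set` s]) (Y i @^-1` B i)) =
    (\prod_(i <- s) P (Y i @^-1` B i))%E.

Definition identically_distributed {d} {T : measurableType d} {R : realType}
  (P : probability T R) (I : Type) (Y : I -> {RV P >-> R}) : Prop :=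
  forall i j (B : set R), measurable B -> P (Y i @^-1` B) = P (Y j @^-1` B).

Definition iid {d} {T : measurableType d} {R : realType}
  (P : probability T R) (I : eqType) (Y : I -> {RV P >-> R}) : Prop :=
  mutually_independent Y /\ identically_distributed Y.

Definition Phi {R : realType} (y : R) : R :=
  fine (normal_prob 0 1 `]-oo, y]).

Definition berry_esseen_constant {R : realType} (C : R) : Prop :=
  forall (d : measure_display) (T : measurableType d) (P : probability T R)
         (Y : nat -> {RV P >-> R}),
    iid Y ->
    ('E_P[Y 0%N] = 0)%E ->
    (0 < 'E_P[(fun t => (Y 0%N t ^+ 2)%R)])%E ->
    ('E_P[(fun t => (`|Y 0%N t| ^+ 3)%R)] < +oo)%E ->
    forall (n : nat) (y : R), (0 < n)%N ->
      `| fine (P [set t | (\sum_(i < n) Y i t) /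
                           Num.sqrt (n%:R * fine ('E_P[(fun t => (Y 0%N t ^+ 2)%R)])%E) <= y])
         - Phi y |
      <= C / Num.sqrt n%:R * fine ('E_P[(fun t => (`|Y 0%N t| ^+ 3)%R)])%E
         / (Num.sqrt (fine ('E_P[(fun t => (Y 0%N t ^+ 2)%R)])%E)) ^+ 3.

(* Gamma(k, theta) density: x^(k-1) e^(-x/theta) / (Gamma(k) theta^k) on x>0;
   the normalizing constant Gamma(k) theta^k is written as the integral. *)
Definition gamma_fun {R : realType} (k theta x : R) : R :=
  x `^ (k - 1) * expR (- x / theta).

Definition pos_reals {R : realType} : set R := `]0, +oo[.

Definition gamma_norm {R : realType} (k theta : R) : R :=
  fine (\int[lebesgue_measure]_(x in pos_reals) (gamma_fun k theta x)%:E)%E.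

Definition gamma_pdf {R : realType} (k theta x : R) : R :=
  if 0 < x then gamma_fun k theta x / gamma_norm k theta else 0.

Definition gamma_distributed {d} {T : measurableType d} {R : realType}
  (P : probability T R) (k theta : R) (X : {RV P >-> R}) : Prop :=
  forall B : set R, measurable B ->
    P (X @^-1` B) = (\int[lebesgue_measure]_(x in B) (gamma_pdf k theta x)%:E)%E.

(* Main.v *)
(* Let S be the sum of the X_i, m = k n and q = ((1 + eps) e^(-eps))^m. Dilating
   the law of S by 1 + eps, resp. by 1 - eps, gives
     P(S >= (1 + eps) m theta) <= q P(S >= m theta),
     P(S <= (1 - eps) m theta) <= ((1 - eps) e^eps)^m P(S <= m theta)
                               <= q P(S <= m theta).
   As S has no atoms, the two probabilities on the right sum to 1, so the
   deviation probability is at most q, and q < delta / (1 + zeta) <= delta as soon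
   as zeta >= 0. Hence the Berry-Esseen inequality only enters through the sign of
   its constant, which is read off by applying it to fair coin tosses, realized
   as binary digits of a uniform point of [0, 1]. *)
Require Import Defs.
From HB Require Import structures.
From mathcomp Require Import all_boot all_order all_algebra.
From mathcomp Require Import all_classical all_reals all_analysis.
From mathcomp Require Import normal_distribution.
From mathcomp Require Import measurable_realfun ring lra.
Set Implicit Arguments. Unset Strict Implicit. Unset Printing Implicit Defensive.
Import Order.TTheory GRing.Theory Num.Theory.
Import numFieldNormedType.Exports.
Local Open Scope classical_set_scope.
Local Open Scope ring_scope.

(** * Affine changes of variable and integration against a density *)

Section lebesgue_affine.
Context {R : realType}.
Local Notation leb := (@lebesgue_measure R).

Let measurable_affine (c b : R) : @measurable_fun _ _ (measurableTypeR R)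
  (measurableTypeR R) [set: R] (fun x => c * x + b).
Proof.
by apply: measurable_funD => //; apply: measurable_funM.
Qed.

(** Both sides are measures in [A], so by uniqueness of Lebesgue measure it suffices to compare them
    on half-open intervals. *)
Lemma lebesgue_measure_affine (c b : R) (A : set R) : 0 < c -> measurable A ->
  leb A = (c%:E * leb ((fun x => c * x + b)%R @^-1` A))%E.
Proof.
move=> c0 mA.
have c0' : 0 <= c by exact: ltW.
pose nu0 := mscale (NngNum c0') (pushforward leb
  (fun x : measurableTypeR R => (c * x + b : measurableTypeR R)%R)).
pose nu := nu0 (measurable_affine c b).
rewrite (@lebesgue_measure_unique R nu) => [//||//].
move=> _ [[x y]] _ <-.
transitivity (c%:E * leb `]((x - b) / c)%R, ((y - b) / c)%R])%E; last first.
  congr (_ * leb _)%E.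
  apply/seteqP; split => z /=; rewrite !in_itv/=
    ltr_pdivrMr// ler_pdivlMr// => /andP[h1 h2]; apply/andP; split; lra.
rewrite !lebesgue_measure_itv/= !lte_fin ltr_pM2r ?invr_gt0// ltrD2r.
case: ifP => _; last by rewrite mule0.
by rewrite -!EFinD -EFinM; congr EFin; field; rewrite gt_eqF.
Qed.

Lemma ge0_integral_dilation (c : R) (f : R -> \bar R) : 0 < c ->
  measurable_fun setT f -> (forall x, 0 <= f x)%E ->
  (\int[leb]_x f x = c%:E * \int[leb]_x f (c * x)%R)%E.
Proof.
move=> c0 mf f0.
have c0' : 0 <= c by exact: ltW.
pose nu0 := mscale (NngNum c0') (pushforward leb
  (fun x : measurableTypeR R => (c * x + 0 : measurableTypeR R)%R)).
pose nu := nu0 (measurable_affine c 0).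
transitivity (\int[nu]_x f x)%E.
  apply: eq_measure_integral => A mA _.
  exact: (lebesgue_measure_affine 0 c0 mA).
rewrite ge0_integral_mscale// ge0_integral_pushforward//=.
by congr (_ * _)%E; apply: eq_integral => x _; rewrite /= addr0.
Qed.

(** [f] and the Radon-Nikodym derivative of [nu] have the same integral over every measurable set,
    hence agree almost everywhere, and the change of variables for the derivative carries over to
    [f]. *)
Lemma ge0_integral_density (nu : probability (measurableTypeR R) R)
    (f : R -> R) (g : R -> \bar R) :
  measurable_fun setT f -> (forall x, 0 <= f x) ->
  (forall B, measurable B -> nu B = \int[leb]_(x in B) (f x)%:E)%E ->
  measurable_fun setT g -> (forall x, 0 <= g x)%E ->
  (\int[nu]_x g x = \int[leb]_x (g x * (f x)%:E))%E.
Proof.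
move=> mf f0 nuE mg g0.
have numu : nu `<< leb.
  apply/null_content_dominatesP => A mA A0.
  by rewrite nuE// null_set_integral//; apply/measurable_EFinP; exact: measurable_funTS.
have intf : leb.-integrable setT (EFin \o f).
  apply/integrableP; split; first exact/measurable_EFinP.
  under eq_integral do rewrite /= ger0_norm//.
  by rewrite -nuE// probability_setT ltry.
rewrite -(Radon_Nikodym_SigmaFinite.change_of_variables numu)//.
apply: ae_eq_integral => //.
- apply: emeasurable_funM => //.
  exact: measurable_int (Radon_Nikodym_SigmaFinite.f_integrable _).
- by apply: emeasurable_funM => //; exact/measurable_EFinP.
- apply: ae_eqe_mul2l; apply: integral_ae_eq => //.
  + exact: Radon_Nikodym_SigmaFinite.f_integrable.
  + exact/measurable_EFinP.
  + move=> E _ mE; transitivity (nu E); last exact: nuE.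
    exact/esym/Radon_Nikodym_SigmaFinite.f_integral.
Qed.

End lebesgue_affine.

(** * The gamma law under dilation *)

Section gamma_dilation.
Context {d} {T : measurableType d} {R : realType} (P : probability T R).
Local Notation leb := (@lebesgue_measure R).

Lemma ge0_integral_RV_density (X : {RV P >-> R}) (f : R -> R) (g : R -> \bar R) :
  measurable_fun setT f -> (forall x, 0 <= f x) ->
  (forall B : set R, measurable B ->
    P (X @^-1` B) = \int[leb]_(x in B) (f x)%:E)%E ->
  measurable_fun setT g -> (forall x, 0 <= g x)%E ->
  (\int[P]_t g (X t) = \int[leb]_x (g x * (f x)%:E))%E.
Proof.
move=> mf f0 XE mg g0.
have mX : @measurable_fun _ _ T (measurableTypeR R) setT X.
  exact: (measurable_funP X : measurable_fun _ (X : T -> R)).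
(* The same function, repacked with the codomain on which [ge0_integral_density] expects its
   probability. *)
pose X' : {mfun T >-> measurableTypeR R} :=
  HB.pack (X : T -> measurableTypeR R) (isMeasurableFun.Build _ _ _ _ _ mX).
rewrite -(@ge0_integral_density _ (distribution P X') f g)//.
by rewrite ge0_integral_distribution.
Qed.

Lemma measurable_gamma_pdf (k theta : R) : measurable_fun setT (gamma_pdf k theta).
Proof.
apply: measurable_fun_if => //.
- exact: measurable_fun_ltr.
- apply: measurable_funTS; apply: measurable_funM => //; apply: measurable_funM.
    exact: measurable_powR.
  apply: measurableT_comp => //; apply: measurable_funM => //.
Qed.

Lemma gamma_fun_ge0 (k theta x : R) : 0 <= gamma_fun k theta x.
Proof. by rewrite mulr_ge0 ?powR_ge0 ?expR_ge0. Qed.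

Lemma gamma_pdf_ge0 (k theta x : R) : 0 <= gamma_pdf k theta x.
Proof.
rewrite /gamma_pdf; case: ifP => // _; rewrite divr_ge0 ?gamma_fun_ge0//.
by apply/fine_ge0/integral_ge0 => y _; rewrite lee_fin gamma_fun_ge0.
Qed.

(** The left side is the density of [c X] at [x]. The power and the exponential each give off a
    factor, while [gamma_norm] appears on both sides and never has to be evaluated. *)
Lemma gamma_pdf_dilation (k theta c x : R) : 0 < c ->
  c^-1 * gamma_pdf k theta (c^-1 * x) =
  c `^ (- k) * expR ((1 - c^-1) * x / theta) * gamma_pdf k theta x.
Proof.
move=> c0; rewrite /gamma_pdf pmulr_rgt0 ?invr_gt0//.
case: ifPn => [x0|_]; last by rewrite !mulr0.
have -> : gamma_fun k theta (c^-1 * x) =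
    c `^ (- k) * c * expR ((1 - c^-1) * x / theta) * gamma_fun k theta x.
  rewrite /gamma_fun powRM ?invr_ge0 ?ltW//.
  have -> : c^-1 `^ (k - 1) = c `^ (- k) * c.
    rewrite -powR_inv1 ?ltW// -powRrM mulN1r opprB addrC powRD ?powRr1 ?ltW//.
    by rewrite (gt_eqF c0) implybT.
  have -> : - (c^-1 * x) / theta = (1 - c^-1) * x / theta + - x / theta by ring.
  by rewrite expRD; ring.
by rewrite -!mulrA (mulrCA _ c) mulKf ?gt_eqF.
Qed.

(* The law of c X, c > 0, has density c^(-k) e^((1 - 1/c) x / theta) with respect
   to the law of X. Unlike the gamma density itself, this property passes to
   independent sums by Fubini alone, without computing a convolution. *)
Definition dilation_law (U : T -> R) (k theta : R) :=
  forall (c : R) (g : R -> \bar R), 0 < c ->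
    measurable_fun setT g -> (forall x, 0 <= g x)%E ->
  (\int[P]_t g (c * U t)%R = (c `^ (- k))%:E *
   \int[P]_t (g (U t) * (expR ((1 - c^-1) * U t / theta))%:E))%E.

Lemma gamma_dilation_law (k theta : R) (X : {RV P >-> R}) :
  gamma_distributed k theta X -> dilation_law X k theta.
Proof.
move=> hX c g c0 mg g0.
have mpdf := measurable_gamma_pdf k theta.
have pdf0 := gamma_pdf_ge0 k theta.
have mgc : measurable_fun setT (fun x => g (c * x)%R).
  by apply: measurableT_comp => //; apply: measurable_funM.
rewrite (ge0_integral_RV_density mpdf pdf0 hX mgc)//.
have mE : measurable_fun setT (fun x : R => (expR ((1 - c^-1) * x / theta))%:E).
  apply/measurable_EFinP; apply: measurableT_comp => //.
  by apply: measurable_funM => //; apply: measurable_funM.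
have mh : measurable_fun setT
    (fun x : R => (g x * (expR ((1 - c^-1) * x / theta))%:E)%E).
  exact: emeasurable_funM.
rewrite (ge0_integral_RV_density mpdf pdf0 hX mh)//; last first.
  by move=> x; rewrite mule_ge0// lee_fin expR_ge0.
(* Substituting [c^-1 x] for [x] produces the dilated density of [gamma_pdf_dilation]. *)
rewrite (@ge0_integral_dilation _ c^-1) ?invr_gt0//; last 2 first.
- apply: emeasurable_funM => //; exact/measurable_EFinP.
- by move=> x; rewrite mule_ge0// lee_fin.
rewrite -!ge0_integralZl//; last 6 first.
- apply: emeasurable_funM => //; exact/measurable_EFinP.
- by move=> x _; rewrite !mule_ge0// lee_fin// expR_ge0.
- by rewrite lee_fin powR_ge0.
- apply: emeasurable_funM; first by apply: measurableT_comp => //; apply: measurableT_comp => //; apply: measurable_funM.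
  by apply/measurable_EFinP; apply: measurableT_comp => //; apply: measurable_funM.
- by move=> x _; rewrite mule_ge0// lee_fin.
- by rewrite lee_fin invr_ge0 ltW.
apply: eq_integral => x _.
rewrite mulrA divff ?gt_eqF// mul1r muleCA -EFinM gamma_pdf_dilation//.
by rewrite -!muleA [RHS]muleCA -!EFinM mulrA.
Qed.

End gamma_dilation.

(** * Independent pairs and product measures *)

Section independent_pairs.
Context {d} {T : measurableType d} {R : realType} (P : probability T R).
Implicit Types U V : {RV P >-> R}.

Definition independent_RVs U V := forall A B : set R, measurable A -> measurable B ->
  P (U @^-1` A `&` V @^-1` B) = (P (U @^-1` A) * P (V @^-1` B))%E.

Let mpair U V : measurable_fun setT (fun t => (U t, V t)).
Proof. by apply/measurable_fun_pairP; split; exact: measurable_funP. Qed.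

(** As functions of [D], both sides are measures which on rectangles equal the product of the law of
    [U] with [P E] times the law of [V]. Uniqueness of the product measure extends the equality to
    every [D]. *)
Lemma independent_RVs_setI U V (E : set T) (D : set (R * R)) :
  measurable E -> measurable D ->
  (forall A B : set R, measurable A -> measurable B ->
    P ((U @^-1` A `&` V @^-1` B) `&` E) =
    (P (U @^-1` A) * P (V @^-1` B) * P E)%E) ->
  independent_RVs U V ->
  P ([set t | D (U t, V t)] `&` E) = (P [set t | D (U t, V t)] * P E)%E.
Proof.
move=> mE mD indE ind.
have PE0 : 0 <= fine (P E) by exact: fine_ge0.
have PEE : (fine (P E))%:E = P E by rewrite fineK// fin_num_measure.
pose m2 := mscale (NngNum PE0) (distribution P V).
pose mu := pushforward (mrestr P mE) (fun t => (U t, V t)).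
pose nu0 := mscale (NngNum PE0) (pushforward P (fun t => (U t, V t))).
have muE : (distribution P U \x m2)%E D = mu D.
  apply: product_measure_unique => // A B mA mB.
  transitivity (P ((U @^-1` A `&` V @^-1` B) `&` E)) => //.
  by rewrite indE//= /m2 /mscale/= PEE -muleA; congr (_ * _)%E; rewrite muleC.
have nuE : (distribution P U \x m2)%E D = nu0 (mpair U V) D.
  apply: product_measure_unique => // A B mA mB.
  transitivity (P E * P (U @^-1` A `&` V @^-1` B))%E; first by rewrite -[in RHS]PEE.
  by rewrite ind//= /m2 /mscale/= PEE muleCA.
by rewrite muleC -PEE; transitivity (nu0 (mpair U V) D) => //; rewrite -nuE muE.
Qed.

(** By independence the joint law is the product of the marginal laws, and Tonelli's theorem
    applies. *)
Lemma ge0_integral_independent_RVs U V (G : R * R -> \bar R) :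
  independent_RVs U V -> measurable_fun setT G -> (forall z, 0 <= G z)%E ->
  (\int[P]_t G (U t, V t) = \int[P]_t \int[P]_s G (U t, V s))%E.
Proof.
move=> ind mG G0.
transitivity (\int[pushforward P (fun t => (U t, V t))]_z G z)%E.
  by rewrite ge0_integral_pushforward.
transitivity (\int[distribution P U \x distribution P V]_z G z)%E.
  apply: eq_measure_integral => A mA _; apply/esym.
  exact: product_measure_unique.
rewrite fubini_tonelli1// ge0_integral_distribution//; last 2 first.
- exact: measurable_fun_fubini_tonelli_F.
- by move=> x; apply: integral_ge0.
apply: eq_integral => t _ /=; rewrite /fubini_F ge0_integral_distribution//.
exact: measurableT_comp.
Qed.

End independent_pairs.

(** * Dilation law and absence of atoms for a sum of two independent variables *)

Section dilation_law_independent.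
Context {d} {T : measurableType d} {R : realType} (P : probability T R).
Implicit Types U V : {RV P >-> R}.

Lemma independent_RVsC U V : independent_RVs U V -> independent_RVs V U.
Proof. by move=> ind A B mA mB; rewrite setIC ind// muleC. Qed.

(** Tonelli freezes the value of [U], and the dilation law of [V] applies to each section of [H].
    This allows the summands to be dilated one at a time. *)
Lemma dilation_law_pair U V (k theta c : R) (H : R * R -> \bar R) :
  independent_RVs U V -> dilation_law P V k theta -> 0 < c ->
  measurable_fun setT H -> (forall z, 0 <= H z)%E ->
  (\int[P]_t H (U t, c * V t)%R = (c `^ (- k))%:E *
   \int[P]_t (H (U t, V t) * (expR ((1 - c^-1) * V t / theta))%:E))%E.
Proof.
move=> ind hV c0 mH H0.
have mE : measurable_fun setT (fun x : R => (expR ((1 - c^-1) * x / theta))%:E).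
  apply/measurable_EFinP; apply: measurableT_comp => //.
  by apply: measurable_funM => //; apply: measurable_funM.
pose G1 (z : R * R) := H (z.1, c * z.2)%R.
have mG1 : measurable_fun setT G1.
  apply: measurableT_comp => //; apply/measurable_fun_pairP; split.
  + exact: measurable_fst.
  + exact: (measurable_funM (measurable_cst c) measurable_snd).
pose G2 (z : R * R) := (H z * (expR ((1 - c^-1) * z.2 / theta))%:E)%E.
have mG2 : measurable_fun setT G2.
  apply: emeasurable_funM => //.
  exact: (measurableT_comp mE measurable_snd).
have G20 z : (0 <= G2 z)%E by rewrite mule_ge0// lee_fin expR_ge0.
rewrite -[LHS]/(\int[P]_t G1 (U t, V t))%E ge0_integral_independent_RVs//; last first.
  by move=> z; exact: H0.
rewrite -[X in (_ * X)%E]/(\int[P]_t G2 (U t, V t))%E ge0_integral_independent_RVs//.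
rewrite -ge0_integralZl//; last 3 first.
- apply: (measurable_fun_fubini_tonelli_F
    (fun z : T * T => G2 (U z.1, V z.2))) => //.
  apply: measurableT_comp => //; apply/measurable_fun_pairP; split.
  + exact: (measurableT_comp (measurable_funP U) measurable_fst).
  + exact: (measurableT_comp (measurable_funP V) measurable_snd).
- by move=> t _; apply: integral_ge0.
- by rewrite lee_fin powR_ge0.
apply: eq_integral => t _.
rewrite -(hV c (fun v => H (U t, v)))//.
exact: measurableT_comp.
Qed.

Lemma dilation_lawD U V (k1 k2 theta : R) :
  independent_RVs U V -> dilation_law P U k1 theta -> dilation_law P V k2 theta ->
  dilation_law P (U \+ V) (k1 + k2) theta.
Proof.
move=> ind hU hV c g c0 mg g0.
have mE : measurable_fun setT (fun x : R => (expR ((1 - c^-1) * x / theta))%:E).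
  apply/measurable_EFinP; apply: measurableT_comp => //.
  by apply: measurable_funM => //; apply: measurable_funM.
under eq_integral do rewrite /= mulrDr.
pose H1 (z : R * R) := g (c * z.1 + z.2).
have mH1 : measurable_fun setT H1.
  apply: measurableT_comp => //; apply: measurable_funD => //.
  exact: (measurable_funM (measurable_cst c) measurable_fst).
have H10 z : (0 <= H1 z)%E by exact: g0.
transitivity (\int[P]_t H1 (U t, c * V t)%R)%E; first by [].
rewrite (dilation_law_pair ind hV c0 mH1 H10).
(* The coordinates are swapped so that [U] is now the dilated one; the weight left by dilating [V]
   is carried along. *)
pose H (z : R * R) := (g (z.2 + z.1)%R * (expR ((1 - c^-1) * z.1 / theta))%:E)%E.
have mH : measurable_fun setT H.
  apply: emeasurable_funM; last exact: (measurableT_comp mE measurable_fst).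
  by apply: measurableT_comp => //; apply: measurable_funD.
have H0 z : (0 <= H z)%E by rewrite mule_ge0// lee_fin expR_ge0.
transitivity ((c `^ (- k2))%:E * \int[P]_t H (V t, c * U t)%R)%E; first by [].
rewrite (dilation_law_pair (independent_RVsC ind) hU c0 mH H0).
rewrite muleA -EFinM -powRD ?(gt_eqF c0) ?implybT// -opprD [k2 + k1]addrC.
congr (_ * _)%E; apply: eq_integral => t _.
rewrite /H/= -muleA -EFinM -expRD; congr (_ * (expR _)%:E)%E.
by ring.
Qed.

(** For a fixed value of [U] the event says that [V] equals [a - U t], which is null; integrating
    over [U] keeps it null. *)
Lemma independent_RVs_sum_atomless U V (a : R) : independent_RVs U V ->
  (forall b, P (V @^-1` [set b]) = 0%E) -> P ((U \+ V) @^-1` [set a]) = 0%E.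
Proof.
move=> ind V0.
have mUV : measurable ((U \+ V) @^-1` [set a]).
  rewrite -[X in measurable X]setTI.
  by apply: (measurable_funD (measurable_funP U) (measurable_funP V)).
have mD : measurable_fun setT (fun z : R * R => z.1 + z.2).
  exact: measurable_funD.
rewrite -(setIT (_ @^-1` _)) -integral_indic//.
pose G (z : R * R) : \bar R := (\1_[set a] (z.1 + z.2)%R)%:E.
have mG : measurable_fun setT G.
  by apply/measurable_EFinP; apply: measurableT_comp.
rewrite -[LHS]/(\int[P]_t G (U t, V t))%E.
rewrite ge0_integral_independent_RVs//; last by move=> z; rewrite lee_fin.
rewrite integral0_eq// => t _.
transitivity (\int[P]_s (\1_(V @^-1` [set (a - U t)%R]) s)%:E)%E.
  apply: eq_integral => s _; rewrite /G !indicE; congr ((nat_of_bool _)%:R%:E).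
  apply/idP/idP; rewrite !inE/= => h; [rewrite -h|rewrite h]; ring.
by rewrite integral_indic// ?setIT//; exact: V0.
Qed.

End dilation_law_independent.

(** * Sums of finite independent families *)

Section sum_of_independent_RVs.
Context {d} {T : measurableType d} {R : realType} (P : probability T R).
Context (I : eqType) (X : I -> {RV P >-> R}).
Hypothesis indX : mutually_independent X.

Definition sum_RV (r : seq I) : {RV P >-> R} :=
  HB.pack (fun t => \sum_(i <- r) X i t)
    (isMeasurableFun.Build _ _ _ _ _
      (measurable_sum r (fun i => measurable_funP (X i)))).

Let block (s : seq I) (B : I -> set R) := \bigcap_(i in [set` s]) (X i @^-1` B i).

Let set_cons (i : I) (s : seq I) : [set` i :: s] = i |` [set` s].
Proof.
apply/seteqP; split => j /=; rewrite inE.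
  by case/orP => [/eqP ->|js]; [left|right].
by case=> [->|js]; apply/orP; [left|right].
Qed.

Let measurable_block s B : (forall i, measurable (B i)) -> measurable (block s B).
Proof.
move=> mB; apply: fin_bigcap_measurable; first exact: finite_seq.
by move=> i _; exact: measurable_funPTI.
Qed.

(** Induction on [r] with [s] general: the variable split off the sum joins the block, so the
    induction hypothesis for [i :: s] makes [X i], the shorter sum and the block independent on
    rectangles. [independent_RVs_setI] then reaches the event on the full sum. *)
Lemma independent_sum_block (r s : seq I) (A : set R) (B : I -> set R) :
  uniq (r ++ s) -> measurable A -> (forall i, measurable (B i)) ->
  P (sum_RV r @^-1` A `&` \bigcap_(i in [set` s]) (X i @^-1` B i)) =
  (P (sum_RV r @^-1` A) * P (\bigcap_(i in [set` s]) (X i @^-1` B i)))%E.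
Proof.
elim: r s A B => [|i r IH] s A B /= us mA mB; rewrite -/(block s B).
  (* The empty sum is the constant 0, so its event is sure or empty. *)
  have -> : sum_RV [::] @^-1` A = if 0 \in A then setT else set0.
    by apply/seteqP; split => t; rewrite /= big_nil; case: ifPn => //;
      rewrite ?inE// notin_setE.
  by case: ifP => _; rewrite ?setTI ?set0I ?probability_setT ?measure0 ?mul1e ?mul0e.
have [/andP[nirs urs] uris] : (i \notin r ++ s) && uniq (r ++ s) /\ uniq (r ++ i :: s).
  by rewrite -cat1s uniq_catCA cat1s /=.
have [nis us'] : i \notin s /\ uniq s.
  by move: nirs urs; rewrite mem_cat negb_or cat_uniq => /andP[_ ->] /and3P[].
(* As [i] is not in [s'], overriding [B] at [i] leaves the block over [s'] unchanged. *)
have splitE s' (A' : set R) : i \notin s' ->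
    block (i :: s') (fun j => if j == i then A' else B j) =
    X i @^-1` A' `&` block s' B.
  move=> nis'; rewrite /block set_cons bigcap_setU1 eqxx; congr (_ `&` _).
  apply: eq_bigcapr => j /= js; case: eqP => // ji.
  by move: nis'; rewrite -ji js.
have mB' (A' : set R) : measurable A' ->
    forall j, measurable (if j == i then A' else B j).
  by move=> mA' j; case: ifP.
have IHs s' (A' C : set R) : i \notin s' -> uniq (r ++ i :: s') ->
    measurable A' -> measurable C ->
    P ((X i @^-1` A' `&` sum_RV r @^-1` C) `&` block s' B) =
    (P (X i @^-1` A') * P (sum_RV r @^-1` C) * P (block s' B))%E.
  move=> nis' us1 mA' mC.
  have us2 : uniq (i :: s') by move: us1; rewrite cat_uniq => /and3P[].
  rewrite (setIC (X i @^-1` _)) -setIA -splitE// IH//; last exact: mB'.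
  rewrite /block (indX us2 (mB' _ mA')) big_cons eqxx.
  rewrite (indX _ mB); last by case/andP: us2.
  rewrite muleCA muleA; congr (_ * _)%E.
  rewrite [LHS]big_seq [RHS]big_seq; apply: eq_bigr => j js'.
  by case: eqP => // ji; move: nis'; rewrite -ji js'.
(* This is the case of the empty block. *)
have ind : independent_RVs (X i) (sum_RV r).
  move=> A' C mA' mC.
  have := IHs [::] A' C isT _ mA' mC.
  rewrite /block set_nil bigcap_set0 setIT probability_setT mule1; apply.
  by move: uris; rewrite -cat_rcons cat_uniq cats1 => /and3P[].
have -> : sum_RV (i :: r) @^-1` A =
    [set t | [set z | A (z.1 + z.2)] (X i t, sum_RV r t)].
  by apply/seteqP; split => t /=; rewrite big_cons.
apply: independent_RVs_setI => //.
- exact: measurable_block.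
- rewrite -[X in measurable X]setTI.
  by apply: (measurable_funD measurable_fst measurable_snd).
- by move=> A' C mA' mC; exact: IHs.
Qed.

Lemma independent_sum_RV (r : seq I) (i : I) : uniq (i :: r) ->
  independent_RVs (sum_RV r) (X i).
Proof.
move=> uir A B mA mB.
have uri : uniq (r ++ [:: i]) by rewrite cats1 rcons_uniq.
have := independent_sum_block uri mA (fun=> mB).
by rewrite set_cons1 !bigcap_set1.
Qed.

Lemma dilation_law_sum_RV (k theta : R) (r : seq I) : uniq r ->
  (forall i, dilation_law P (X i) k theta) ->
  dilation_law P (sum_RV r) (k * (size r)%:R) theta.
Proof.
move=> + hX; elim: r => [_|i r IH /[dup] uir /= /andP[_ ur]].
  (* The empty sum has shape 0: the power and the exponential weight are both 1. *)
  move=> c g c0 mg g0; rewrite mulr0 oppr0 powRr0 mul1e.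
  apply: eq_integral => t _; rewrite /= big_nil !mulr0 mul0r expR0 mule1//.
have := dilation_lawD (independent_sum_RV uir) (IH ur) (hX i).
rewrite -{2}[k]mulr1 -mulrDr natr1.
congr (dilation_law P _ _ _).
by apply/funext => t /=; rewrite big_cons addrC.
Qed.

Lemma sum_RV_atomless (r : seq I) (a : R) : uniq r -> r != [::] ->
  (forall i b, P (X i @^-1` [set b]) = 0%E) -> P (sum_RV r @^-1` [set a]) = 0%E.
Proof.
case: r => // i r uir _ X0.
rewrite -[RHS](independent_RVs_sum_atomless a (independent_sum_RV uir) (X0 i)).
by congr (P _); apply/seteqP; split => t /=; rewrite big_cons addrC.
Qed.

End sum_of_independent_RVs.

(** * Exponential rates and tail bounds *)

Section gamma_tails.
Context {R : realType}.

(** The difference [h] vanishes at 0 and has derivative [x (e^x - e^(-x))], which is nonnegative for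
    [x >= 0]. This is why the lower tail obeys the upper tail's rate. *)
Lemma exp_log_deviation (eps : R) : 0 <= eps ->
  (1 - eps) * expR eps <= (1 + eps) * expR (- eps).
Proof.
move=> eps0.
pose h (x : R) := (1 + x) * expR (- x) - (1 - x) * expR x.
have dh (x : R) : is_derive x 1 h (x * (expR x - expR (- x))).
  rewrite /h; apply: is_derive_eq.
  by rewrite /GRing.scale/=; ring.
have hcont : {within `[0, eps], continuous h}.
  apply: continuous_subspaceT => x.
  exact/differentiable_continuous/derivable1_diffP/(@ex_derive _ _ _ _ _ _ _ (dh x)).
have [x] := MVT_segment eps0 (fun x _ => dh x) hcont.
rewrite in_itv/= => /andP[x0 _] hE.
have h0 : h 0 = 0 by rewrite /h oppr0 expR0; ring.
move: hE; rewrite h0 !subr0 => hE.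
rewrite -subr_ge0 -[leRHS]/(h eps) hE !mulr_ge0 ?subr_ge0 ?ler_expR//; lra.
Qed.

Lemma ln1D_lt (eps : R) : 0 < eps -> ln (1 + eps) < eps.
Proof.
move=> eps0; rewrite -[ltRHS]expRK ltr_ln ?posrE ?expR_gt0 ?expR_gt1Dx ?gt_eqF//.
by lra.
Qed.

(** [a] is the dilation factor for the lower tail: [1 - eps <= a] ensures that the dilated event
    covers this tail, and the last clause gives it the rate of the upper tail. For [eps < 1] that
    clause is the logarithm of [exp_log_deviation]; for [eps >= 1] the witness makes [ln a + 1]
    equal to the required rate. *)
Lemma lower_tail_rate (eps : R) : 0 < eps ->
  exists a : R, [/\ 0 < a, a < 1, 1 - eps <= a &
    ln a + (1 - a) <= - (eps - ln (1 + eps))].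
Proof.
move=> eps0; have [eps1|eps1] := ltP eps 1.
- exists (1 - eps); split; [lra..|].
  have := exp_log_deviation (ltW eps0).
  have e1 : 0 < 1 - eps by lra.
  have e2 : 0 < 1 + eps by lra.
  rewrite -ler_ln ?posrE ?mulr_gt0 ?expR_gt0//.
  by rewrite !lnM ?posrE ?expR_gt0// !expRK; lra.
- (* The event is null when eps >= 1; a small dilation factor still suffices. *)
  pose a := expR (- (1 + eps - ln (1 + eps))).
  have a0 : 0 < a by exact: expR_gt0.
  exists a; split => //; first 2 last.
  + by rewrite expRK; lra.
  + by rewrite expR_lt1; have := ln1D_lt eps0; lra.
  + by lra.
Qed.

Context {d} {T : measurableType d} (P : probability T R).

Lemma gamma_atomless (k theta : R) (X : {RV P >-> R}) (b : R) :
  gamma_distributed k theta X -> P (X @^-1` [set b]) = 0%E.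
Proof. by move=> ->//; rewrite integral_set1. Qed.

(** The dilation law with factor [a^-1] and the indicator of [D] yields [a^m] times an exponential
    weight, bounded on [D] by [e^((1 - a) m)]. The probability of [D] is kept as a factor so that
    two tails can later share a single bound. *)
Lemma dilation_law_tail (S : {RV P >-> R}) (m theta a : R) (D : set R) :
  dilation_law P S m theta -> 0 < a -> measurable D ->
  (forall x, D x -> (1 - a) * x / theta <= (1 - a) * m) ->
  (P [set t | D (a^-1 * S t)%R] <= (expR (m * (ln a + (1 - a))))%R%:E * P (S @^-1` D))%E.
Proof.
move=> hS a0 mD Dm.
have mSD : measurable (S @^-1` D) by exact: measurable_funPTI.
have maS : measurable [set t | D (a^-1 * S t)%R].
  rewrite -[X in measurable X]setTI.
  by apply: (measurable_funM (measurable_cst a^-1) (measurable_funP S)).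
have mI : measurable_fun setT (fun x : R => (\1_D x)%:E : \bar R).
  exact/measurable_EFinP.
have := @hS a^-1 (fun x => (\1_D x)%:E) _ mI _.
rewrite invr_gt0 => /(_ a0) h.
rewrite -[in leLHS](setIT [set t | _]) -integral_indic// h; last first.
  by move=> x; rewrite lee_fin.
rewrite invrK -(powR_inv1 (ltW a0)) -powRrM mulN1r opprK.
apply: (@le_trans _ _ ((a `^ m)%:E *
    \int[P]_t ((expR ((1 - a) * m))%:E * (\1_(S @^-1` D) t)%:E))%E); last first.
  rewrite ge0_integralZl//; last exact/measurable_EFinP/measurable_indic.
  rewrite integral_indic// setIT muleA -EFinM /powR gt_eqF// -expRD mulrDr.
  by rewrite (mulrC m (1 - a)).
apply: lee_wpmul2l; first by rewrite lee_fin powR_ge0.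
apply: ge0_le_integral => //.
- apply: emeasurable_funM.
    by apply: (measurableT_comp mI); exact: measurable_funP.
  apply/measurable_EFinP; apply: measurableT_comp => //.
  apply: measurable_funM => //; apply: measurable_funM => //.
- by apply: emeasurable_funM => //; exact/measurable_EFinP/measurable_indic.
- move=> t _; rewrite muleC -[in leRHS]/((\1_D (S t))%:E) -!EFinM lee_fin.
  have [St|St] := boolP (S t \in D); last by rewrite !indicE (negbTE St) !mulr0.
  by rewrite ler_wpM2r// ler_expR Dm// -inE.
Qed.

End gamma_tails.

Lemma measurable_deviation {R : realType} {d} {T : measurableType d}
    (P : probability T R) (S : {RV P >-> R}) (m theta c : R) :
  measurable [set t | `|S t / m - theta| < c].
Proof.
rewrite (_ : mkset _ = (fun t => `|S t / m - theta|) @^-1` `]-oo, c[).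
  rewrite -[X in measurable X]setTI.
  have mdiv : measurable_fun setT (fun t => S t / m - theta).
    by apply: measurable_funB => //; apply: measurable_funM.
  have mnorm : measurable_fun setT (fun t => `|S t / m - theta|).
    exact: measurableT_comp.
  exact: mnorm.
by apply/seteqP; split => t; rewrite /= in_itv.
Qed.

Lemma dilation_law_deviation {R : realType} {d} {T : measurableType d}
    (P : probability T R) (S : {RV P >-> R}) (m theta eps : R) :
  dilation_law P S m theta -> 0 < m -> 0 < theta -> 0 < eps ->
  P (S @^-1` [set m * theta]) = 0%E ->
  (P (~` [set t | (`|S t / m - theta| < eps * theta)%R]) <=
   (expR (- (m * (eps - ln (1 + eps)))))%R%:E)%E.
Proof.
move=> hS m0 th0 eps0 S0.
set q := expR _.
have [a [a0 a1 aeps arate]] := lower_tail_rate eps0.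
have e0 : 0 < 1 + eps by lra.
pose U := [set x : R | m * theta <= x].
pose L := [set x : R | x <= m * theta].
have UE : U = `[m * theta, +oo[%classic.
  by apply/seteqP; split => x /=; rewrite /U in_itv/= andbT.
have LE : L = `]-oo, m * theta]%classic.
  by apply/seteqP; split => x /=; rewrite /L in_itv.
have mU : measurable U by rewrite UE.
have mL : measurable L by rewrite LE.
(* With [a = 1 + eps] the coefficient [1 - a] is negative, so the weight is largest at the left end
   [m theta] of [U]. *)
have upper : (P [set t | U ((1 + eps)^-1 * S t)%R] <= q%:E * P (S @^-1` U))%E.
  have -> : q = expR (m * (ln (1 + eps) + (1 - (1 + eps)))).
    by congr expR; ring.
  apply: (dilation_law_tail hS e0 mU) => x; rewrite /U/= => Ux.
  rewrite -mulrA ler_wnM2l ?ler_pdivlMr//; lra.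
have lower : (P [set t | L (a^-1 * S t)%R] <= q%:E * P (S @^-1` L))%E.
  apply: (@le_trans _ _ ((expR (m * (ln a + (1 - a))))%:E * P (S @^-1` L))%E).
    apply: (dilation_law_tail hS a0 mL) => x; rewrite /L/= => Lx.
    rewrite -mulrA ler_wpM2l ?ler_pdivrMr//; lra.
  rewrite lee_wpmul2r// lee_fin ler_expR -mulrN ler_wpM2l//.
  exact: ltW.
have mSD D : measurable D -> measurable (S @^-1` D).
  by move=> mD; exact: measurable_funPTI.
have msc c D : measurable D -> measurable [set t | D (c * S t)].
  move=> mD; rewrite -[X in measurable X]setTI.
  by apply: (measurable_funM (measurable_cst c) (measurable_funP S)).
have mdev := measurable_deviation S m theta (eps * theta).
(* The half-lines [U] and [L] overlap only at [m theta], a null point by hypothesis. *)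
have UL1 : (P (S @^-1` U) + P (S @^-1` L) <= 1)%E.
  have -> : S @^-1` L = (~` (S @^-1` U)) `|` S @^-1` [set m * theta].
    apply/seteqP; split => t; rewrite /L /U/=.
      rewrite le_eqVlt => /orP[/eqP|]; [by right|left].
      by apply/negP; rewrite -ltNge.
    by case=> [/negP|->//]; rewrite -ltNge => /ltW.
  have PC := probability_setC P (mSD _ mU).
  have -> : P ((~` (S @^-1` U)) `|` S @^-1` [set m * theta]) =
      (1 - P (S @^-1` U))%E.
    by rewrite -PC; apply: measureU0 => //; exact/measurableC/mSD.
  by rewrite addeC subeK// fin_num_measure//; exact: mSD.
(* An upper deviation dilates into [U]. A lower one dilates into [L] because [1 - eps <= a]. *)
apply: (@le_trans _ _ (P ([set t | U ((1 + eps)^-1 * S t)%R] `|`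
    [set t | L (a^-1 * S t)%R]))).
  apply: le_measure; rewrite ?inE.
  - exact: measurableC.
  - by apply: measurableU; exact: msc.
  move=> t /= /negP; rewrite -leNgt ler_normr /U /L => /orP[h|h]; [left|right] => /=.
    rewrite ler_pdivlMl//.
    have : (1 + eps) * theta <= S t / m by lra.
    by rewrite ler_pdivlMr//; lra.
  rewrite ler_pdivrMl//.
  have : S t / m <= (1 - eps) * theta by lra.
  rewrite ler_pdivrMr// => h1; apply: (le_trans h1).
  have : 0 <= (a - (1 - eps)) * (theta * m).
    by rewrite mulr_ge0 ?subr_ge0// mulr_ge0// ltW.
  lra.
apply: (le_trans (measureU2 _ _ _)); [exact: msc|exact: msc|].
apply: (le_trans (leeD upper lower)).
by rewrite -ge0_muleDr// -[leRHS]mule1 lee_wpmul2l// lee_fin expR_ge0.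
Qed.

(** * Fair coin tosses from binary digits, and the sign of the Berry-Esseen constant *)

Section coin_tosses.
Context {R : realType}.
Local Notation leb := (@lebesgue_measure R).
Local Notation unif := (uniform_prob (@ltr01 R)).

(** On [[0, 1)] this is the binary shift, which drops the first digit. *)
Definition doubling (x : R) : R := if x < 2^-1 then 2 * x else 2 * x - 1.
(** The first binary digit, with digit 0 read as 1 and digit 1 as -1. *)
Definition coin (x : R) : R := if x < 2^-1 then 1 else - 1.

Lemma measurable_doubling : @measurable_fun _ _ (measurableTypeR R)
  (measurableTypeR R) setT doubling.
Proof.
have m2 : measurable_fun setT (fun x : R => 2 * x) by exact: measurable_funM.
have m3 : measurable_fun setT (fun x : R => 2 * x - 1) by exact: measurable_funB.
have : measurable_fun setT doubling.
  apply: measurable_fun_if => //.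
  - exact: measurable_fun_ltr.
  - exact: measurable_funTS m3.
exact.
Qed.

Lemma measurable_coin : @measurable_fun _ _ (measurableTypeR R) R setT coin.
Proof.
have : measurable_fun setT coin.
  by apply: measurable_fun_if => //; exact: measurable_fun_ltr.
exact.
Qed.

(** The null point 1 is discarded so that [doubling] maps each of two half-open halves onto
    [[0, 1)]. *)
Let unifE (E : set R) : measurable E -> unif E = leb (E `&` `[0, 1[).
Proof.
move=> mE; rewrite /uniform_prob integral_uniform_pdf.
rewrite (eq_integral (fun=> 1%E)); last first.
  by move=> x /set_mem[_]; rewrite /= in_itv/= /uniform_pdf => ->; rewrite subr0 invr1.
rewrite integral_cst//= ?mul1e; last exact: measurableI.
rewrite -(@setUitv1 _ _ (BLeft 0) 1 true) ?bnd_simp// setIUr.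
apply: measureU0 => /=.
- exact: measurableI.
- exact: measurableI.
- apply: countable_lebesgue_measure0; apply: sub_countable (countable1 (1 : R)).
  by apply: subset_card_le; exact: subIsetr.
Qed.

(* Under the uniform law the first binary digit and the remaining ones are
   independent, and the latter are again uniform. *)
Lemma coin_doubling (A E : set R) : measurable A -> measurable E ->
  unif (coin @^-1` A `&` doubling @^-1` E) =
  (((\1_A 1 + \1_A (- 1)) / 2)%R%:E * unif E)%E.
Proof.
move=> mA mE.
have mcA : measurable (coin @^-1` A).
  by rewrite -[X in measurable X]setTI; exact: measurable_coin.
have mdE : measurable (doubling @^-1` E).
  by rewrite -[X in measurable X]setTI; exact: measurable_doubling.
rewrite !unifE//; last exact: measurableI.
pose F := E `&` `[0, 1[%classic.
have mF : measurable F by exact: measurableI.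
pose H0 := (fun x => 2 * x + 0) @^-1` F.
pose H1 := (fun x => 2 * x + (- 1)) @^-1` F.
have half b : leb ((fun x => 2 * x + b) @^-1` F) = (2^-1%:E * leb F)%E.
  rewrite (@lebesgue_measure_affine R 2 b F)// muleA -EFinM mulVf// mul1e//.
have H01 : H0 `<=` `[0, 2^-1[.
  by move=> x [_]; rewrite /= !in_itv/= => /andP[? ?]; apply/andP; split; lra.
have H11 : H1 `<=` `[2^-1, 1[.
  by move=> x [_]; rewrite /= !in_itv/= => /andP[? ?]; apply/andP; split; lra.
have mH b : measurable ((fun x : R => 2 * x + b) @^-1` F).
  rewrite -[X in measurable X]setTI.
  have ma : measurable_fun setT (fun x : R => 2 * x + b).
    by apply: measurable_funD => //; apply: measurable_funM.
  exact: ma.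
(* The coin is 1 on the branch [H0] and -1 on [H1], so [A] merely selects branches, each of half the
   measure of [F]. *)
have -> : (coin @^-1` A `&` doubling @^-1` E) `&` `[0, 1[ =
    ((if 1 \in A then H0 else set0) `|` (if - 1 \in A then H1 else set0)).
  apply/seteqP; split => x.
    rewrite /coin /doubling/= in_itv/= => -[[]].
    have [x2|x2] := ltP x 2^-1 => Ax Ex /andP[x0 x1]; [left|right].
      rewrite mem_set//; split; rewrite ?addr0// /= in_itv/=; lra.
    rewrite mem_set//; split => //; rewrite /= in_itv/=; lra.
  case; case: ifPn => // /set_mem Ax Hx.
    have := H01 _ Hx; rewrite /= !in_itv/= => /andP[x0 x1].
    rewrite /coin /doubling x1; move: Hx; rewrite /H0 /= addr0 => -[Ex _].
    split => //; lra.
  have := H11 _ Hx; rewrite /= !in_itv/= => /andP[x0 x1].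
  rewrite /coin /doubling ltNge x0/=; move: Hx; rewrite /H1 /= => -[Ex _].
  split => //; lra.
have mH0 : measurable H0 by exact: mH.
have mH1 : measurable H1 by exact: mH.
have hH0 : leb H0 = (2^-1%:E * leb F)%E by exact: half.
have hH1 : leb H1 = (2^-1%:E * leb F)%E by exact: half.
have tH : H0 `&` H1 = set0.
  rewrite -subset0 => x [/H01 + /H11]; rewrite /= !in_itv/= => /andP[_ x1] /andP[x2 _].
  by move: x1; rewrite ltNge x2.
rewrite !indicE; case: (1 \in A); case: (- 1 \in A) => /=.
- by rewrite measureU// [X in (X + _)%E]hH0 [X in (_ + X)%E]hH1 -ge0_muleDl ?lee_fin// -EFinD; congr (_%:E * _)%E; field.
- by rewrite setU0 [LHS]hH0; congr (_%:E * _)%E; field.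
- by rewrite set0U [LHS]hH1; congr (_%:E * _)%E; field.
- by rewrite setU0 measure0 addr0 mul0r mul0e.
Qed.

Definition toss (i : nat) (x : R) : R := coin (iter i doubling x).

Let tossS i : toss i.+1 = toss i \o doubling.
Proof. by apply/funext => x; rewrite /toss iterSr. Qed.

Lemma measurable_iter_doubling i : @measurable_fun _ _ (measurableTypeR R)
  (measurableTypeR R) setT (iter i doubling).
Proof. by elim: i => [|i IH]; [exact: measurable_id|exact: (measurableT_comp measurable_doubling IH)]. Qed.

Lemma measurable_toss i : @measurable_fun _ _ (measurableTypeR R) R setT (toss i).
Proof. exact: (measurableT_comp measurable_coin (measurable_iter_doubling i)). Qed.

Definition toss_RV i : {RV unif >-> R} :=
  HB.pack (toss i) (isMeasurableFun.Build _ _ _ _ _ (measurable_toss i)).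

(** The law of a fair sign. *)
Let w (B : set R) : \bar R := ((\1_B 1 + \1_B (- 1)) / 2)%R%:E.

Let wT : w setT = 1%E.
Proof. by rewrite /w !indicE !in_setT /=; congr EFin; field. Qed.

Let unif_coin (B : set R) : measurable B -> unif (coin @^-1` B) = w B.
Proof.
move=> mB; have := coin_doubling mB measurableT.
by rewrite preimage_setT setIT probability_setT mule1.
Qed.

(** [coin_doubling] with the sure event for the coin says that [doubling] preserves the uniform law,
    so every toss has the law of the first. *)
Let unif_toss i (B : set R) : measurable B -> unif (toss i @^-1` B) = w B.
Proof.
move=> mB; elim: i => [|i <-]; first exact: unif_coin.
have mi : measurable (toss i @^-1` B).
  by rewrite -[X in measurable X]setTI; exact: measurable_toss.
have := coin_doubling measurableT mi.
rewrite -/(w setT) wT preimage_setT setTI mul1e => <-.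
by rewrite tossS.
Qed.

(** The later tosses are the tosses of the doubled point, so [coin_doubling] splits off the first
    one. *)
Let unif_first_tosses N (B : nat -> set R) : (forall i, measurable (B i)) ->
  unif (\bigcap_(i < N) (toss i @^-1` B i)) = (\prod_(i < N) w (B i))%E.
Proof.
elim: N B => [|N IH] B mB.
  by rewrite II0 bigcap_set0 probability_setT big_ord0.
rewrite big_ord_recl -(IH (fun i => B i.+1))//.
rewrite -coin_doubling//; last first.
  apply: fin_bigcap_measurable; first exact: finite_II.
  by move=> i _; rewrite -[X in measurable X]setTI; exact: measurable_toss.
congr (unif _); apply/seteqP; split => x /=.
  move=> h; split; first exact: (h 0).
  by move=> i /= iN; have := h i.+1 iN; rewrite /= tossS.
move=> [h0 h] [|i]//= iN.
by have := h i iN; rewrite /= tossS.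
Qed.

Lemma iid_toss : iid toss_RV.
Proof.
split; last first.
  by move=> i j B mB; exact: etrans (unif_toss i mB) (esym (unif_toss j mB)).
move=> s B us mB.
(* Indices outside [s] receive the sure event, of weight 1, which extends the family to an initial
   segment of the naturals. *)
pose B' i := if i \in s then B i else setT.
have mB' i : measurable (B' i) by rewrite /B'; case: ifP.
pose N := (\max_(i <- s) i).+1.
have sN i : i \in s -> (i < N)%N by move=> si; rewrite ltnS leq_bigmax_seq.
transitivity (\prod_(i < N) w (B' i))%E.
  rewrite -(unif_first_tosses N mB'); congr (unif _).
  apply/seteqP; split => x h i /= si.
    by rewrite /B'; case: ifP => // si'; exact: h.
  by have := h i (sN i si); rewrite /B' si.
rewrite [RHS](eq_bigr (fun i => w (B i)))//; last by move=> i _; exact: unif_toss.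
rewrite -(big_mkord xpredT (fun i => w (B' i))).
transitivity (\prod_(0 <= i < N) if i \in s then w (B i) else 1)%E.
  by apply: eq_bigr => i _; rewrite /B'; case: ifP.
rewrite -big_mkcond -big_filter; apply: perm_big; apply: uniq_perm => //.
  by rewrite filter_uniq// iota_uniq.
move=> i; rewrite mem_filter mem_index_iota/=.
by case: (boolP (i \in s)) => // /sN ->.
Qed.

Let tossE i x : toss i x = 1 \/ toss i x = - 1.
Proof. by rewrite /toss /coin; case: ifP; [left|right]. Qed.

(** The positive and negative parts of a toss are the indicators of its two values, each of mass
    1/2. *)
Lemma expectation_toss : ('E_unif[toss_RV 0] = 0)%E.
Proof.
have half (c : R) : c ^+ 2 = 1 ->
    (\int[unif]_x (\1_(toss 0 @^-1` [set c]) x)%:E = 2^-1%:E)%E.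
  move=> c2; rewrite integral_indic ?setIT//; last first.
    by rewrite -[X in measurable X]setTI; exact: measurable_toss.
  transitivity (w [set c]); first exact: unif_toss.
  move/eqP: c2; rewrite sqrf_eq1 /w !indicE !in_set1 => /orP[/eqP->|/eqP->].
    rewrite eqxx (_ : (- 1 == 1) = false) ?addr0 ?mul1r//.
    by apply/negbTE/eqP; lra.
  rewrite eqxx (_ : (1 == - 1) = false) ?add0r ?mul1r//.
  by apply/negbTE/eqP; lra.
rewrite unlock integralE.
rewrite (_ : integral _ _ _ = 2^-1%:E); last first.
  rewrite -(half 1) ?expr1n//; apply: eq_integral => x _.
  rewrite funeposE indicE/=; have [t1|t1] := tossE 0 x; rewrite t1.
    by rewrite mem_set//; apply/max_idPl; rewrite lee_fin.
  rewrite memNset/= ?t1; last lra.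
  by apply/max_idPr; rewrite lee_fin; lra.
rewrite (_ : integral _ _ _ = 2^-1%:E) ?subee//.
rewrite -(half (- 1)) ?sqrrN ?expr1n//; apply: eq_integral => x _.
rewrite funenegE indicE/=; have [t1|t1] := tossE 0 x; rewrite t1.
  rewrite memNset/= ?t1; last lra.
  by apply/max_idPr; rewrite lee_fin; lra.
by rewrite mem_set// opprK; apply/max_idPl; rewrite lee_fin.
Qed.

(** A toss has second and third absolute moments 1, so at [n = 1] the right side of the inequality
    is [C] itself, and it dominates an absolute value. *)
Lemma berry_esseen_constant_ge0 (C : R) : berry_esseen_constant C -> 0 <= C.
Proof.
have sq : (fun x => toss 0 x ^+ 2) = cst 1.
  by apply/funext => x; have [->|->] := tossE 0 x; rewrite ?sqrrN expr1n.
have cu : (fun x => `|toss 0 x| ^+ 3) = cst 1.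
  by apply/funext => x; have [->|->] := tossE 0 x; rewrite ?normrN normr1 expr1n.
have E2 : ('E_unif[fun x => (toss_RV 0 x ^+ 2)%R] = 1)%E.
  by transitivity ('E_unif[cst 1%R])%E; [rewrite -sq|exact: expectation_cst].
have E3 : ('E_unif[fun x => (`|toss_RV 0 x| ^+ 3)%R] = 1)%E.
  by transitivity ('E_unif[cst 1%R])%E; [rewrite -cu|exact: expectation_cst].
move=> /(_ _ _ _ _ iid_toss expectation_toss).
rewrite E2 E3 => /(_ _ _ 1%N 0 isT).
rewrite lte_fin ltr01 ltry => /(_ isT isT) /(le_trans (normr_ge0 _)).
by rewrite /= !sqrtr1 expr1n !divr1 mulr1.
Qed.

End coin_tosses.

(** * The confidence bound for the estimator of [theta] *)

Theorem theorem6 (R : realType) (C_BE : R) (HC : berry_esseen_constant C_BE)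
  (d : measure_display) (T : measurableType d) (P : probability T R)
  (k theta : R) (n : nat) (X : 'I_n -> {RV P >-> R})
  (hk : 0 < k) (htheta : 0 < theta)
  (hiid : iid X) (hgamma : forall i, gamma_distributed k theta (X i))
  (eps delta : R) (heps : 0 < eps) (hdelta0 : 0 < delta) (hdelta1 : delta < 1) :
  let thetahat := fun t => (\sum_(i < n) X i t) / (k * n%:R) in
  let zeta := 2 * C_BE * (3 + 6 / k) `^ (3 / 4) *
              Num.sqrt (k * (eps - ln (1 + eps)) / ln (1 / delta)) in
  ln ((1 + zeta) / delta) / (k * (eps - ln (1 + eps))) < n%:R ->
  ((1 - delta)%:E < P [set t | (`|thetahat t - theta| < eps * theta)%R])%E.
Proof.
move=> thetahat zeta hn.
have L0 : 0 < eps - ln (1 + eps) by rewrite subr_gt0 ln1D_lt.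
have kL0 : 0 < k * (eps - ln (1 + eps)) by rewrite mulr_gt0.
have zeta0 : 0 <= zeta.
  by rewrite !mulr_ge0 ?sqrtr_ge0 ?powR_ge0// (berry_esseen_constant_ge0 HC).
clearbody zeta.
have lnd : ln delta^-1 <= ln ((1 + zeta) / delta).
  by rewrite ler_ln ?posrE ?divr_gt0 ?invr_gt0 ?ler_peMl ?invr_ge0 ?(ltW hdelta0)//; lra.
have lnd0 : 0 < ln delta^-1 by rewrite ln_gt0// invf_gt1.
(* The threshold is nonnegative, so the strict bound excludes [n = 0], where the estimator would
   divide by 0. *)
have n0 : (0 < n)%N.
  rewrite -(ltr0n R); apply: le_lt_trans hn.
  by rewrite divr_ge0 ?(ltW kL0)// (le_trans _ lnd)// ltW.
have m0 : 0 < k * n%:R by rewrite mulr_gt0// ltr0n.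
pose S := sum_RV X (index_enum 'I_n).
have uI : uniq (index_enum 'I_n) by exact: index_enum_uniq.
have sI : size (index_enum 'I_n) = n.
  by rewrite [index_enum _]unlock -enumT size_enum_ord.
have hS : dilation_law P S (k * n%:R) theta.
  have hX i : dilation_law P (X i) k theta by exact: gamma_dilation_law.
  by have := dilation_law_sum_RV (proj1 hiid) uI hX; rewrite sI.
have S0 : P (S @^-1` [set (k * n%:R) * theta]) = 0%E.
  apply: sum_RV_atomless => //; first by case: hiid.
    by rewrite -size_eq0 sI -lt0n.
  by move=> i b; exact: gamma_atomless (hgamma i).
set E := [set t | _].
have mE : measurable E.
  exact: (measurable_deviation S (k * n%:R) theta (eps * theta)).
have : (P (~` E) <= (expR (- (k * n%:R * (eps - ln (1 + eps)))))%:E)%E.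
  exact: (dilation_law_deviation hS m0 htheta heps S0).
rewrite (_ : P (~` E) = 1 - P E)%E; last exact: probability_setC.
rewrite -(fineK (fin_num_measure P E mE)) -EFinB lte_fin lee_fin.
(* In logarithms this is the hypothesis on [n], combined with [lnd]. *)
suff : expR (- (k * n%:R * (eps - ln (1 + eps)))) < delta by lra.
rewrite -[ltRHS]lnK ?posrE// ltr_expR ltrNl -[ltLHS]lnV ?posrE//.
apply: (le_lt_trans lnd); rewrite mulrAC -ltr_pdivrMl// mulrC.
exact: hn.
Qed.
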